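(* Let $\eta_0>0$, $\xi>0$, $0<k_c<\infty$, $\eta_1>-2$. The integral scale of the three-dimensional FGC-SSRF with parameters $(\eta_0,\eta_1,\xi,k_c)$ is $$I_3=\xi\left[\frac{4\pi^2}{V_3(\eta_1,k_c\xi)}\right]^{1/3},$$ and in the asymptotic regime $k_c\to\infty$ (with $\eta_1,\xi$ fixed) it tends to the following limit, which is linear in $\xi$: $$I_3(\eta_1,\xi)=\begin{cases}2\,\xi\,(\pi\,\beta_2)^{1/3}, & |\eta_1|<2,\\ 2\,\xi\,\pi^{1/3}, & \eta_1=2,\\ 2\,\xi\left[\dfrac{\pi(\omega_1+\omega_2)}{2}\right]^{1/3}, & \eta_1>2.\end{cases}$$
   Context: The three-dimensional FGC-SSRF with parameters $(\eta_0,\eta_1,\xi,k_c)$ is the stationary, isotropic, zero-mean Gaussian random field on $\mathbb{R}^3$ with covariance spectral density $\tilde G(\mathbf{k})=\eta_0\xi^3/(1+\eta_1(|\mathbf{k}|\xi)^2+(|\mathbf{k}|\xi)^4)$ for $|\mathbf{k}|\le k_c$ and $\tilde G(\mathbf{k})=0$ for $|\mathbf{k}|>k_c$, and covariance function $G(\mathbf{r})=\frac{1}{(2\pi)^3}\int_{|\mathbf{k}|\le k_c}e^{i\mathbf{k}\cdot\mathbf{r}}\tilde G(\mathbf{k})\,d\mathbf{k}$. Its integral scale is $I_3=\left[\int G(\mathbf{r})\,d\mathbf{r}\,/\,G(0)\right]^{1/3}$, where $\int G(\mathbf{r})\,d\mathbf{r}$ is understood as $\tilde G(0)=\eta_0\xi^3$;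 that is, $I_3=[\tilde G(0)/G(0)]^{1/3}$. Notation: $\Delta=|\eta_1^2-4|^{1/2}$; $\beta_1=\frac{|2-\eta_1|^{1/2}}{2}$, $\beta_2=\frac{|2+\eta_1|^{1/2}}{2}$; $\omega_1=\left(\frac{|\eta_1-\Delta|}{2}\right)^{1/2}$, $\omega_2=\left(\frac{|\eta_1+\Delta|}{2}\right)^{1/2}$; and $$V_3(\eta_1,x)=\begin{cases}\dfrac{1}{4\beta_1}\ln\!\left(\dfrac{x^2-2\beta_1x+1}{x^2+2\beta_1x+1}\right)+\dfrac{1}{2\beta_2}\displaystyle\sum_{l=\pm1}\tan^{-1}\!\left(\dfrac{x+l\beta_1}{\beta_2}\right), & |\eta_1|<2,\\[3mm] \tan^{-1}(x)-\dfrac{x}{1+x^2}, & \eta_1=2,\\[3mm] \dfrac{2}{\Delta}\displaystyle\sum_{l=1,2}(-1)^{l}\,\omega_l\,\tan^{-1}\!\left(\dfrac{x}{\omega_l}\right), & \eta_1>2.\end{cases}$$ *)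

(* Defs.v *)
From HB Require Import structures.
From mathcomp Require Import all_boot all_order all_algebra.
From mathcomp Require Import complex.
From mathcomp Require Import all_classical all_reals all_analysis.

Set Implicit Arguments.
Unset Strict Implicit.
Unset Printing Implicit Defensive.

Import Order.TTheory GRing.Theory Num.Theory.
Import numFieldNormedType.Exports.

Local Open Scope classical_set_scope.
Local Open Scope ring_scope.
Local Open Scope complex_scope.

Section Space.
Context {R : realType}.
Implicit Types k r : R * R * R.

Definition dot3 k r : R := k.1.1 * r.1.1 + k.1.2 * r.1.2 + k.2 * r.2.

(* The norm the library puts on a product is the sup norm, hence this one. *)
Definition norm3 k : R := Num.sqrt (dot3 k k).

Definition lebesgue3 :=
  ((@lebesgue_measure R \x @lebesgue_measure R) \x @lebesgue_measure R)%E.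

Definition expi (t : R) : R[i] := cos t +i* sin t.

Definition Cintegral3 (D : set (R * R * R)) (f : R * R * R -> R[i]) : R[i] :=
  (\int[lebesgue3]_(k in D) complex.Re (f k)) +i*
  (\int[lebesgue3]_(k in D) complex.Im (f k)).

End Space.

Section RandomField.
Context {R : realType} {d : measure_display} {T : measurableType d}.
Variables (P : probability T R) (X : R * R * R -> {RV P >-> R}).

(* Finite linear combinations are normal; standard deviation 0 means constant
   almost surely, a case that normal_prob does not cover. *)
Definition gaussian_field : Prop :=
  forall (n : nat) (t : 'I_n -> R * R * R) (a : 'I_n -> R),
  exists m s : R, forall A : set R, measurable A ->
    P [set w | A (\sum_(i < n) a i * X (t i) w)] =
    if s == 0 then \d_m A else normal_prob m s A.

Definition zero_mean_field : Prop := forall s, ('E_P[X s] = 0)%E.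

Definition covfun (r : R * R * R) : R := fine (covariance P (X r) (X 0)).

(* For a zero-mean Gaussian field, invariance of the covariance under
   translations is invariance of all finite-dimensional distributions. *)
Definition stationary_field : Prop :=
  forall s r, covariance P (X (s + r)) (X s) = (covfun r)%:E.

Definition isotropic_field : Prop :=
  forall r r', norm3 r = norm3 r' -> covfun r = covfun r'.

(* S is the covariance spectral density of X, and the integral of the covariance
   function over space is understood as S 0. *)
Definition integral_scale (S : R * R * R -> R) : R :=
  (S 0 / covfun 0) `^ (3^-1).

End RandomField.

Section FGC.
Context {R : realType}.
Variables eta0 eta1 xi kc : R.

Definition fgc_density (k : R * R * R) : R :=
  if norm3 k <= kc then
    eta0 * xi ^+ 3 / (1 + eta1 * (norm3 k * xi) ^+ 2 + (norm3 k * xi) ^+ 4)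
  else 0.

Definition fgc_covariance (r : R * R * R) : R[i] :=
  (((2 * pi) ^+ 3)^-1)%:C *
  Cintegral3 [set k | norm3 k <= kc]
             (fun k => expi (dot3 k r) * (fgc_density k)%:C).

Record is_FGC_SSRF {d : measure_display} {T : measurableType d}
    (P : probability T R) (X : R * R * R -> {RV P >-> R}) : Prop := {
  fgc_gaussian : gaussian_field X ;
  fgc_zero_mean : zero_mean_field X ;
  fgc_stationary : stationary_field X ;
  fgc_isotropic : isotropic_field X ;
  fgc_covfun : forall r, (covfun X r)%:C = fgc_covariance r }.

End FGC.

Section Formulas.
Context {R : realType}.
Variable eta1 : R.

Definition Delta : R := Num.sqrt `|eta1 ^+ 2 - 4|.
Definition beta1 : R := Num.sqrt `|2 - eta1| / 2.
Definition beta2 : R := Num.sqrt `|2 + eta1| / 2.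
Definition omega1 : R := Num.sqrt (`|eta1 - Delta| / 2).
Definition omega2 : R := Num.sqrt (`|eta1 + Delta| / 2).

(* Meant for -2 < eta1, so that the last branch is the case 2 < eta1. *)
Definition V3 (x : R) : R :=
  if `|eta1| < 2 then
    1 / (4 * beta1) * ln ((x ^+ 2 - 2 * beta1 * x + 1) /
                          (x ^+ 2 + 2 * beta1 * x + 1)) +
    1 / (2 * beta2) * (atan ((x - beta1) / beta2) + atan ((x + beta1) / beta2))
  else if eta1 == 2 then
    atan x - x / (1 + x ^+ 2)
  else
    2 / Delta * (- (omega1 * atan (x / omega1)) + omega2 * atan (x / omega2)).

(* Same convention on eta1 as V3. *)
Definition limit_scale (xi : R) : R :=
  if `|eta1| < 2 then 2 * xi * (pi * beta2) `^ (3^-1)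
  else if eta1 == 2 then 2 * xi * pi `^ (3^-1)
  else 2 * xi * (pi * (omega1 + omega2) / 2) `^ (3^-1).

End Formulas.

(* Main.v *)
Require Import Defs.
From HB Require Import structures.
From mathcomp Require Import all_boot all_order all_algebra.
From mathcomp Require Import all_classical all_reals all_analysis.
From mathcomp Require Import complex measurable_realfun ring lra.

Set Implicit Arguments.
Unset Strict Implicit.
Unset Printing Implicit Defensive.

Import Order.TTheory GRing.Theory Num.Theory.
Import numFieldNormedType.Exports.

Local Open Scope classical_set_scope.
Local Open Scope ring_scope.

(** Putting [r = 0] in the spectral representation, [G(0)] is [(2 pi)^-3] times
    the integral of a radial function over the ball of radius [kc].  That
    integral is found from the volumes of balls alone: as functions of the
    radius [r], it and the primitive of [4 pi r^2 f(r)] have increments over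
    [[a, b]] that differ by [O((b - a)^2)], because [f] is Lipschitz, so their
    difference is constant.  Since [V3] is twice the primitive of
    [x^2 / (1 + eta1 x^2 + x^4)] vanishing at [0], this gives
    [G(0) = eta0 V3(kc xi) / (4 pi^2)].  The limit [kc -> +oo] then follows from
    the limit of [V3], in which each arctangent tends to [pi / 2] and the
    remaining terms vanish. *)

(** * The volume of the ball *)

(** For [t < 0] the set is empty and [Num.sqrt t] is 0, so one formula serves every slice of the
    ball, empty slices included. *)
Lemma lebesgue_measure_sqr_le (R : realType) (t : R) :
  lebesgue_measure [set y : R | y ^+ 2 <= t] = (2 * Num.sqrt t)%:E.
Proof.
have [t0|t0] := leP 0 t; last first.
  rewrite ler0_sqrtr ?ltW// mulr0 (_ : [set _ | _] = set0) ?measure0//.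
  by apply/seteqP; split=> // y /= yt; have := sqr_ge0 y; lra.
rewrite (_ : [set _ | _] = `[- Num.sqrt t, Num.sqrt t]%classic).
  rewrite lebesgue_measure_itv/= lte_fin; have := sqrtr_ge0 t; rewrite le_eqVlt.
  case/predU1P => [<-|s0]; first by rewrite oppr0 ltxx mulr0.
  by rewrite gtrN// -EFinD; congr EFin; ring.
apply/seteqP; split => y /=; rewrite in_itv/= -ler_norml.
  by move=> /ler_wsqrtr; rewrite sqrtr_sqr.
by move=> yt; rewrite -real_normK ?num_real// -(sqr_sqrtr t0) lerXn2r// nnegrE ?sqrtr_ge0.
Qed.

Lemma integral_itv_is_derive (R : realType) (f F : R -> R) (a b : R) :
  a <= b -> continuous f -> (forall x : R, is_derive x (1 : R) F (f x)) ->
  (\int[lebesgue_measure]_(x in `[a, b]) (f x)%:E = (F b - F a)%:E)%E.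
Proof.
rewrite le_eqVlt => /predU1P[-> _ _|ab cf dF].
  by rewrite set_itv1 integral_set1 subrr.
have cF : continuous F.
  by move=> x; apply/differentiable_continuous/derivable1_diffP; have [] := dF x.
rewrite (continuous_FTC2 (F := F)) ?EFinB//; first exact: continuous_subspaceT.
  split; [by move=> x _; have [] := dF x| |].
    exact/cvg_at_right_filter/cF.
  exact/cvg_at_left_filter/cF.
by move=> x _; rewrite derive1E derive_val.
Qed.

Lemma continuous_sqrt_sub_sqr (R : realType) (c s : R) :
  continuous (fun x : R => c * Num.sqrt (s - x ^+ 2)).
Proof.
move=> x; apply: cvgM; first exact: cvg_cst.
apply: (@continuous_comp _ _ _ (fun x : R => s - x ^+ 2) Num.sqrt).
  by apply: cvgB; [exact: cvg_cst|exact: exprn_continuous].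
exact: sqrt_continuous.
Qed.

(** The area of a disc as the integral of its chord lengths. The substitution [x = r sin t] turns
    the integrand into [2 r^2 cos^2 t], whose primitive is [r^2 (t + sin t cos t)]. *)
Lemma integral_sqrt_sub_sqr (R : realType) (r : R) : 0 < r ->
  (\int[lebesgue_measure]_(x in `[(- r)%R, r]) (2 * Num.sqrt (r ^+ 2 - x ^+ 2))%:E
   = (pi * r ^+ 2)%:E)%E.
Proof.
move=> r0; pose F (t : R) := r * sin t.
have dF t : is_derive t (1 : R) F (r * cos t).
  by rewrite /F; apply: is_deriveZ.
have F' : F^`()%classic = fun t => r * cos t.
  by apply/funext => t; rewrite derive1E derive_val.
have cF : continuous F by move=> t; apply: cvgM; [exact: cvg_cst|exact: continuous_sin].
have cF' : continuous (fun t => r * cos t).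
  by move=> t; apply: cvgM; [exact: cvg_cst|exact: continuous_cos].
have piN : - (pi / 2) <= pi / 2 :> R by have := pi_ge0 R; lra.
have Fa : F (- (pi / 2)) = - r by rewrite /F sinN sin_pihalf mulrN1.
have Fb : F (pi / 2) = r by rewrite /F sin_pihalf mulr1.
rewrite -{1}Fa -{1}Fb integration_by_substitution_increasing//; first last.
- exact/continuous_subspaceT/continuous_sqrt_sub_sqr.
- split; [by move=> t _; have [] := dF t| |].
    exact/cvg_at_right_filter/cF.
  exact/cvg_at_left_filter/cF.
- by rewrite F'; apply/cvg_ex; eexists; apply: cvg_at_left_filter; exact: cF'.
- by rewrite F'; apply/cvg_ex; eexists; apply: cvg_at_right_filter; exact: cF'.
- by rewrite F' => t _; exact: cF'.
- by move=> x y xI yI xy; rewrite /F ltr_pM2l// ltr_sin.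
rewrite F'.
transitivity (\int[lebesgue_measure]_(t in `[(- (pi / 2))%R, (pi / 2)%R])
  (2 * r ^+ 2 * cos t ^+ 2)%:E)%E.
  apply: eq_integral => t; rewrite inE/= in_itv/= => tI.
  rewrite /F /= !fctE; congr EFin.
  have -> : r ^+ 2 - (r * sin t) ^+ 2 = (r * cos t) ^+ 2.
    by rewrite !exprMn sin2cos2; ring.
  by rewrite sqrtr_sqr ger0_norm; [ring|rewrite mulr_ge0 ?(ltW r0)// cos_ge0_pihalf].
pose G (t : R) := r ^+ 2 * (t + sin t * cos t).
have dG t : is_derive t (1 : R) G (2 * r ^+ 2 * cos t ^+ 2).
  apply: is_derive_eq; rewrite /GRing.scale/= -!expr2 mulrN -expr2 sin2cos2; ring.
have cG : continuous (fun t : R => 2 * r ^+ 2 * cos t ^+ 2).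
  by move=> t; apply: cvgM; [exact: cvg_cst|apply: cvgM; exact: continuous_cos].
rewrite (integral_itv_is_derive piN cG dG) /G sinN cosN cos_pihalf !mulr0.
by congr EFin; field.
Qed.

(** The square root is 0 where [x^2 > s], so the integral over the whole line is still the area of
    the disc of squared radius [s]; the maximum with 0 covers the empty discs. *)
Lemma integralT_sqrt_sub_sqr (R : realType) (s : R) :
  (\int[lebesgue_measure]_x (2 * Num.sqrt (s - x ^+ 2))%:E
   = (pi * Num.max s 0)%:E)%E.
Proof.
have [s0|s0] := leP s 0.
  rewrite mulr0; apply: integral0_eq => x _.
  by rewrite ler0_sqrtr ?mulr0// subr_le0 (le_trans s0)// sqr_ge0.
have r0 : 0 < Num.sqrt s by rewrite sqrtr_gt0.
rewrite -(sqr_sqrtr (ltW s0)) -integral_sqrt_sub_sqr// [RHS]integral_mkcond/=.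
apply: eq_integral => x _; rewrite patchE; case: ifPn => //.
rewrite notin_setE/= in_itv/= -ler_norml => /negP; rewrite -ltNge => rx.
rewrite ler0_sqrtr ?mulr0// subr_le0 -(real_normK (num_real x)).
by rewrite lerXn2r ?nnegrE// ltW.
Qed.

Lemma measurable_norm3 (R : realType) : measurable_fun setT (@norm3 R).
Proof.
have m11 : measurable_fun setT (fun k : R * R * R => k.1.1).
  by apply: (measurableT_comp (f := fst)); exact: measurable_fst.
have m12 : measurable_fun setT (fun k : R * R * R => k.1.2).
  by apply: (measurableT_comp (f := snd)); [exact: measurable_snd|exact: measurable_fst].
have m2 : measurable_fun setT (fun k : R * R * R => k.2) by exact: measurable_snd.
rewrite (_ : @norm3 R = (@Num.sqrt R \o (fun k => dot3 k k)))//.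
rewrite /dot3; apply: measurableT_comp.
  by apply: continuous_measurable_fun; exact: sqrt_continuous.
by apply: measurable_funD; [apply: measurable_funD|]; exact: measurable_funM.
Qed.

Lemma norm3_ge0 (R : realType) (k : R * R * R) : 0 <= norm3 k.
Proof. exact: sqrtr_ge0. Qed.

Lemma norm3_le (R : realType) (k : R * R * R) (r : R) : 0 <= r ->
  (norm3 k <= r) = (k.1.1 ^+ 2 + k.1.2 ^+ 2 <= r ^+ 2 - k.2 ^+ 2).
Proof.
move=> r0; rewrite lerBrDr -(ler_sqrt _ (sqr_ge0 r)) sqrtr_sqr (ger0_norm r0).
by rewrite /norm3 /dot3 !expr2.
Qed.

Definition ball3 (R : realType) (r : R) : set (R * R * R) := [set k | norm3 k <= r].

Lemma measurable_ball3 (R : realType) (r : R) : measurable (ball3 r).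
Proof.
have -> : ball3 r = setT `&` @norm3 R @^-1` `]-oo, r].
  by rewrite setTI; apply/seteqP; split => k; rewrite /ball3/= in_itv.
exact: measurable_norm3.
Qed.

(** Slicing one coordinate at a time: the fibre over [(x, y)] is a segment of length
    [2 sqrt (r^2 - x^2 - y^2)], integrating over [y] gives a disc of area [pi max (r^2 - x^2, 0)],
    and what remains is the integral of a polynomial over [[-r, r]]. *)
Lemma ball3_volume (R : realType) (r : R) : 0 <= r ->
  lebesgue3 (ball3 r) = (4 / 3 * pi * r ^+ 3)%:E.
Proof.
move=> r0; rewrite /lebesgue3 {1}/product_measure1.
under eq_integral => p _.
  rewrite /= (_ : xsection _ p = [set z | z ^+ 2 <= r ^+ 2 - p.1 ^+ 2 - p.2 ^+ 2]).
    rewrite lebesgue_measure_sqr_le; over.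
  apply/seteqP; split => z; rewrite /xsection/ball3/= inE/= norm3_le//= => h; lra.
pose g (p : R * R) := (2 * Num.sqrt (r ^+ 2 - p.1 ^+ 2 - p.2 ^+ 2))%:E.
have mg : measurable_fun setT g.
  apply/measurable_EFinP; apply: measurable_funM => //.
  apply: (@measurableT_comp _ _ _ _ _ _ (@Num.sqrt R)).
    by apply: continuous_measurable_fun; exact: sqrt_continuous.
  apply: measurable_funB; [apply: measurable_funB => //|]; apply: measurable_funX.
    exact: measurable_fst.
  exact: measurable_snd.
have g0 p : (0 <= g p)%E by rewrite lee_fin mulr_ge0// sqrtr_ge0.
transitivity (\int[lebesgue_measure]_x fubini_F (@lebesgue_measure R) g x)%E.
  by rewrite -(fubini_tonelli1 (m1 := lebesgue_measure))//; exact: eq_integral.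
transitivity (\int[lebesgue_measure]_(x in setT)
    (pi * Num.max (r ^+ 2 - x ^+ 2) 0)%:E)%E.
  apply: eq_integral => x _; rewrite -integralT_sqrt_sub_sqr.
  exact: eq_integral.
have Fr : - r <= r by rewrite ge0_cp.
pose G (z : R) := pi * (r ^+ 2 * z - z ^+ 3 / 3).
have dG z : is_derive z (1 : R) G (pi * (r ^+ 2 - z ^+ 2)).
  by apply: is_derive_eq; rewrite /GRing.scale/=; field.
have cG : continuous (fun z : R => pi * (r ^+ 2 - z ^+ 2)).
  move=> z; apply: cvgM; first exact: cvg_cst.
  by apply: cvgB; [exact: cvg_cst|exact: exprn_continuous].
have -> : 4 / 3 * pi * r ^+ 3 = G r - G (- r) by rewrite /G; field.
rewrite -(integral_itv_is_derive Fr cG dG) [RHS]integral_mkcond/=.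
apply: eq_integral => x _; rewrite patchE; case: ifPn => [|].
  rewrite inE/= in_itv/= -ler_norml => xr; rewrite max_l// subr_ge0.
  by rewrite -(real_normK (num_real x)) lerXn2r ?nnegrE.
rewrite notin_setE/= in_itv/= -ler_norml => /negP; rewrite -ltNge => rx.
rewrite max_r ?mulr0// subr_le0 -(real_normK (num_real x)) lerXn2r ?nnegrE//.
exact: ltW.
Qed.

(** * Integrals of radial functions *)

(** Over [2^n] equal pieces of the interval the increments add up to at most
    [2^n K ((b - a) / 2^n)^2], which tends to 0. *)
Lemma eq_of_sqr_modulus (R : realType) (H : R -> R) (a b K : R) : a <= b ->
  (forall x y, a <= x -> x <= y -> y <= b -> `|H y - H x| <= K * (y - x) ^+ 2) ->
  H b = H a.
Proof.
move=> ab HK.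
(* Induction by bisection: at level [n] each half of [[x, y]] contributes at most [K (y - x)^2 / 4],
   so the two together leave room for one more factor 2. *)
have halve n : forall x y, a <= x -> x <= y -> y <= b ->
    2 ^+ n * `|H y - H x| <= K * (y - x) ^+ 2.
  elim: n => [x y ax xy yb|n IH x y ax xy yb]; first by rewrite mul1r HK.
  have m1 : x <= (x + y) / 2 by lra.
  have m2 : (x + y) / 2 <= y by lra.
  have := IH _ _ ax m1 (le_trans m2 yb); have := IH _ _ (le_trans ax m1) m2 yb.
  have tri := ler_normD (H y - H ((x + y) / 2)) (H ((x + y) / 2) - H x).
  rewrite addrA subrK in tri; have p2 : 0 < 2 ^+ n :> R by rewrite exprn_gt0.
  have -> : K * (y - (x + y) / 2) ^+ 2 = K * (y - x) ^+ 2 / 4 by field.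
  have -> : K * ((x + y) / 2 - x) ^+ 2 = K * (y - x) ^+ 2 / 4 by field.
  move=> u1 u2; have := ler_wpM2l (ltW p2) tri; rewrite mulrDr => u3.
  by rewrite exprS -mulrA; lra.
apply/eqP; rewrite -subr_eq0 -normr_eq0 eq_le normr_ge0 andbT leNgt.
(* This [n] exceeds the ratio of the bound to a nonzero increment, and [n < 2^n] then contradicts
   [halve]. *)
apply/negP => e0; pose n := Num.bound `|K * (b - a) ^+ 2 / `|H b - H a| |.
have := halve n _ _ (lexx a) ab (lexx b).
apply/negP; rewrite -ltNge -ltr_pdivrMr//.
apply: (le_lt_trans (ler_norm _)); apply: lt_trans (archi_boundP (normr_ge0 _)) _.
by rewrite -natrX ltr_nat ltn_expl.
Qed.

(** A bounded measurable function on a set of finite measure is integrable, and integrating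
    [|g - v| <= e] gives the estimate. On a thin shell [v] is the value at the inner radius. *)
Lemma Rintegral_near_cst d (T : measurableType d) (R : realType)
    (mu : {measure set T -> \bar R}) (A : set T) (g : T -> R) (V v e : R) :
  measurable A -> mu A = V%:E -> measurable_fun A g ->
  (forall x, A x -> `|g x - v| <= e) ->
  mu.-integrable A (EFin \o g) /\
  `|\int[mu]_(x in A) g x - v * V| <= e * V.
Proof.
move=> mA muAE mg ge; have muA : (mu A < +oo)%E by rewrite muAE ltry.
have ig : mu.-integrable A (EFin \o g).
  apply: measurable_bounded_integrable => //; exists (e + `|v|); split.
    exact: num_real.
  move=> M /ltW eM x Ax /=; apply: le_trans eM; rewrite -[g x](subrK v).
  by apply: le_trans (ler_normD _ _) _; rewrite lerD2r ge.
have ic (u : R) : mu.-integrable A (EFin \o cst u).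
  apply: measurable_bounded_integrable => //; exists `|u|; split.
    exact: num_real.
  by move=> M /ltW uM x Ax.
have -> : V = fine (mu A) by rewrite muAE.
split=> //; rewrite -!Rintegral_cst// -RintegralB//; last exact: ic.
apply: le_trans (le_normr_Rintegral _ _) _ => //.
  exact: (integrableB mA ig (ic v)).
apply: le_Rintegral => //; last exact: ic.
exact/integrable_norm/(integrableB mA ig (ic v)).
Qed.

Lemma Rintegral_setD d (T : measurableType d) (R : realType)
    (mu : {measure set T -> \bar R}) (A B : set T) (g : T -> R) :
  measurable A -> measurable B -> B `<=` A -> mu.-integrable A (EFin \o g) ->
  \int[mu]_(x in A) g x - \int[mu]_(x in B) g x = \int[mu]_(x in A `\` B) g x.
Proof.
move=> mA mB BA iA.
have -> : \int[mu]_(x in A) g x = \int[mu]_(x in B `|` (A `\` B)) g x.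
  by rewrite setDUK.
rewrite Rintegral_setU ?setDUK//; first by rewrite addrAC subrr add0r.
  exact: measurableD.
by apply/disj_setPS => x [Bx [_]].
Qed.

(* Both sides change by [f a] times the volume of the shell between [a] and
   [b], up to an error quadratic in [b - a]. *)
Lemma Rintegral_ball3_radial (R : realType) (f G : R -> R) (c L : R) :
  0 <= c -> 0 <= L -> measurable_fun setT f ->
  (forall x y, 0 <= x -> x <= y -> y <= c -> `|f y - f x| <= L * (y - x)) ->
  (forall x : R, is_derive x (1 : R) G (4 * pi * x ^+ 2 * f x)) ->
  \int[lebesgue3]_(k in ball3 c) f (norm3 k) = G c - G 0.
Proof.
move=> c0 L0 mf Lf dG; pose fn (k : R * R * R) := f (norm3 k).
have mfn A : measurable_fun A fn.
  apply: measurable_funTS; apply: measurableT_comp => //; exact: measurable_norm3.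
have Voo r : 0 <= r -> (lebesgue3 (@ball3 R r) < +oo)%E.
  by move=> r0; rewrite ball3_volume// ltry.
have shellV a b : 0 <= a -> a <= b ->
    lebesgue3 (@ball3 R b `\` ball3 a) = (4 / 3 * pi * (b ^+ 3 - a ^+ 3))%:E.
  move=> a0 ab; have b0 := le_trans a0 ab.
  have mb := @measurable_ball3 R b; have ma := @measurable_ball3 R a.
  have e : (lebesgue3 (ball3 b `\` ball3 a) =
      lebesgue3 (ball3 b) - lebesgue3 (ball3 b `&` ball3 a))%E.
    exact: (@measureD _ _ _ (@lebesgue3 R) _ _ mb ma (Voo b b0)).
  rewrite e setIidr; last by move=> k; rewrite /ball3/= => /le_trans; apply.
  by rewrite !ball3_volume// -EFinB; congr EFin; ring.
pose F r := \int[lebesgue3]_(k in ball3 r) fn k.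
have FB a b : 0 <= a -> a <= b -> b <= c ->
    F b - F a = \int[lebesgue3]_(k in ball3 b `\` ball3 a) fn k.
  move=> a0 ab bc; have b0 := le_trans a0 ab.
  (* This crude bound serves only to make [fn] integrable on the ball. *)
  have bnd k : ball3 b k -> `|fn k - f 0| <= L * c.
    move=> kb; apply: le_trans (Lf 0 _ _ _ _) _; rewrite ?norm3_ge0//.
      exact: le_trans bc.
    by rewrite subr0 ler_wpM2l// (le_trans kb).
  have [iF _] := @Rintegral_near_cst _ _ _ (@lebesgue3 R) _ _ _ _ _
    (measurable_ball3 b) (ball3_volume b0) (mfn _) bnd.
  apply: (@Rintegral_setD _ _ _ (@lebesgue3 R)) iF.
  - exact: measurable_ball3.
  - exact: measurable_ball3.
  - by move=> k /le_trans; apply.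
(* The ball of radius 0 has volume 0 and [fn] equals [f 0] on it, so the estimate holds with error
   0. *)
have F0 : F 0 = 0.
  have bnd k : ball3 0 k -> `|fn k - f 0| <= 0.
    move=> k0; have /eqP e : norm3 k == 0 by rewrite eq_le norm3_ge0 andbT.
    by rewrite /fn e subrr normr0.
  have [_] := @Rintegral_near_cst _ _ _ (@lebesgue3 R) _ _ _ _ _
    (measurable_ball3 0) (ball3_volume (lexx 0)) (mfn _) bnd.
  by rewrite expr0n/= !mulr0 subr0 normr_le0 => /eqP.
suff : F c - G c = F 0 - G 0 by rewrite F0 => e; rewrite -/(F c); lra.
(* The constant adds two errors of [4 pi c^2 L (b - a)^2]: [dF] for the integral and [dGV] for the
   primitive. *)
apply: (@eq_of_sqr_modulus _ (fun r => F r - G r) 0 c (8 * pi * c ^+ 2 * L)) => //.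
move=> a b a0 ab bc; have b0 := le_trans a0 ab; have pi0 := pi_ge0 R.
pose V := 4 / 3 * pi * (b ^+ 3 - a ^+ 3).
(* The volume of the shell is at most its thickness times the area of the sphere of radius [c]. *)
have Vle : V <= 4 * pi * c ^+ 2 * (b - a).
  rewrite /V -subr_ge0.
  have -> : 4 * pi * c ^+ 2 * (b - a) - 4 / 3 * pi * (b ^+ 3 - a ^+ 3) =
    4 / 3 * (pi * ((b - a) * ((c ^+ 2 - a ^+ 2) + (c ^+ 2 - a * b) + (c ^+ 2 - b ^+ 2)))).
    by field.
  have ac := le_trans ab bc.
  apply: mulr_ge0; first lra.
  apply: mulr_ge0 => //; apply: mulr_ge0; first by rewrite subr_ge0.
  have acS : a ^+ 2 <= c ^+ 2 by rewrite lerXn2r ?nnegrE.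
  have bcS : b ^+ 2 <= c ^+ 2 by rewrite lerXn2r ?nnegrE.
  have abc : a * b <= c ^+ 2 by rewrite expr2 ler_pM.
  lra.
have dF : `|F b - F a - f a * V| <= 4 * pi * c ^+ 2 * L * (b - a) ^+ 2.
  have bnd k : (ball3 b `\` ball3 a) k -> `|fn k - f a| <= L * (b - a).
    move=> [kb /negP]; rewrite -ltNge => /ltW ak.
    apply: le_trans (Lf a _ _ _ _) _ => //; first exact: le_trans bc.
    by rewrite ler_wpM2l// lerD2r.
  have mS := measurableD (measurable_ball3 b) (measurable_ball3 a).
  have [_] := @Rintegral_near_cst _ _ _ (@lebesgue3 R) _ _ _ _ _
    mS (shellV a b a0 ab) (mfn _) bnd.
  rewrite -/V FB// => /le_trans; apply.
  apply: le_trans (ler_wpM2l _ Vle) _; first by rewrite mulr_ge0// subr_ge0.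
  by rewrite le_eqVlt; apply/orP; left; apply/eqP; ring.
have dGV : `|G b - G a - f a * V| <= 4 * pi * c ^+ 2 * L * (b - a) ^+ 2.
  (* Subtracting [f a] times the volume of the ball leaves the derivative [4 pi r^2 (f r - f a)],
     which the mean value theorem and the Lipschitz bound control. *)
  pose phi r := G r - f a * (4 / 3 * pi * r ^+ 3).
  have dphi r : is_derive r (1 : R) phi (4 * pi * r ^+ 2 * (f r - f a)).
    by apply: is_derive_eq; rewrite /GRing.scale/=; field.
  have cphi : {within `[a, b], continuous phi}.
    apply: continuous_subspaceT => r; apply/differentiable_continuous/derivable1_diffP.
    by have [] := dphi r.
  have [r] := MVT_segment ab (fun r _ => dphi r) cphi.
  rewrite in_itv/= => /andP[ar rb] phiE.
  have -> : G b - G a - f a * V = phi b - phi a by rewrite /phi /V; ring.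
  have rc := le_trans rb bc; have r0 := le_trans a0 ar.
  have p4 : 0 <= 4 * pi :> R by rewrite mulr_ge0.
  have -> : 4 * pi * c ^+ 2 * L * (b - a) ^+ 2 =
    4 * pi * c ^+ 2 * (L * (b - a)) * (b - a) by ring.
  rewrite phiE normrM (ger0_norm (_ : 0 <= b - a)) ?subr_ge0// normrM.
  rewrite (ger0_norm (_ : 0 <= 4 * pi * r ^+ 2)); last by rewrite mulr_ge0// sqr_ge0.
  apply: ler_wpM2r; first by rewrite subr_ge0.
  apply: ler_pM => //; first by rewrite mulr_ge0// sqr_ge0.
    by rewrite ler_wpM2l// lerXn2r ?nnegrE.
  apply: le_trans (Lf a _ _ _ _) _ => //.
  by rewrite ler_wpM2l// lerD2r.
have -> : F b - G b - (F a - G a) =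
  (F b - F a - f a * V) - (G b - G a - f a * V) by ring.
apply: le_trans (ler_normB _ _) _.
by apply: le_trans (lerD dF dGV) _; lra.
Qed.

(** * The function V3 *)

Lemma is_derive_atan_scaled (R : realType) (a b x : R) : 0 < b ->
  is_derive x (1 : R) (fun x : R => atan ((x + a) / b)) (b / (b ^+ 2 + (x + a) ^+ 2)).
Proof.
move=> b0; have bneq0 : b != 0 by rewrite gt_eqF.
have e : b ^+ 2 + (x + a) ^+ 2 != 0.
  by rewrite gt_eqF// ltr_wpDr ?sqr_ge0// exprn_gt0.
apply: (is_derive_eq (@is_derive1_comp _ atan (fun x : R => (x + a) / b) x _ _ _ _)).
by rewrite /GRing.scale/=; field; rewrite e bneq0.
Qed.

Lemma is_derive_ln_comp (R : realType) (g : R -> R) (x dg : R) : 0 < g x ->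
  is_derive x (1 : R) g dg -> is_derive x (1 : R) (fun x : R => ln (g x)) (dg / g x).
Proof.
move=> gx dgx; rewrite mulrC.
exact: (@is_derive1_comp _ (@ln R) g x _ _ (is_derive1_ln gx) dgx).
Qed.

(** The polynomial is a square plus [(2 + eta1) x^2], which is positive for [x != 0]. *)
Lemma fgc_denominator_gt0 (R : realType) (eta1 x : R) : -2 < eta1 ->
  0 < 1 + eta1 * x ^+ 2 + x ^+ 4.
Proof.
move=> h; have [->|x0] := eqVneq x 0; first by rewrite !expr0n/= mulr0 !addr0.
have -> : 1 + eta1 * x ^+ 2 + x ^+ 4 = (1 - x ^+ 2) ^+ 2 + (2 + eta1) * x ^+ 2 by ring.
rewrite ltr_wpDl ?sqr_ge0// mulr_gt0//; first by lra.
by rewrite exprn_even_gt0.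
Qed.

Section V3_derivative.
Variables (R : realType) (eta1 : R).

Lemma beta12E : -2 < eta1 < 2 ->
  [/\ 0 < beta1 eta1, 0 < beta2 eta1, beta1 eta1 ^+ 2 = (2 - eta1) / 4
    & beta2 eta1 ^+ 2 = (2 + eta1) / 4].
Proof.
move=> /andP[h1 h2]; rewrite /beta1 /beta2.
have p1 : 0 < 2 - eta1 by lra.
have p2 : 0 < 2 + eta1 by lra.
rewrite !gtr0_norm// !divr_gt0 ?sqrtr_gt0// !expr_div_n !sqr_sqrtr ?ltW//.
by split => //; congr (_ / _); ring.
Qed.

(** The squares of [omega1] and [omega2] are the roots of [t^2 - eta1 t + 1], so the denominator
    factors as [(omega1^2 + x^2) (omega2^2 + x^2)]. *)
Lemma omega12E : 2 < eta1 ->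
  [/\ 0 < omega1 eta1, 0 < omega2 eta1, 0 < Delta eta1,
    omega2 eta1 ^+ 2 - omega1 eta1 ^+ 2 = Delta eta1 &
    omega1 eta1 ^+ 2 + omega2 eta1 ^+ 2 = eta1 /\
    omega1 eta1 * omega2 eta1 = 1].
Proof.
move=> h; rewrite /omega1 /omega2; set D := Delta eta1.
have p : 0 < eta1 ^+ 2 - 4.
  by rewrite (_ : _ - _ = (eta1 - 2) * (eta1 + 2)); [rewrite mulr_gt0//; lra|ring].
have D0 : 0 < D by rewrite sqrtr_gt0 gtr0_norm.
have D2 : D ^+ 2 = eta1 ^+ 2 - 4 by rewrite sqr_sqrtr gtr0_norm// ltW.
have Dlt : 0 < eta1 - D.
  by rewrite subr_gt0 -(ltr_pXn2r (n := 2)) ?nnegrE ?D2 //; lra.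
have Dgt : 0 < eta1 + D by lra.
rewrite !gtr0_norm// !sqr_sqrtr ?divr_ge0 ?ltW//.
split => //; try by rewrite sqrtr_gt0 divr_gt0.
  by field.
split; first by field.
rewrite -sqrtrM ?divr_ge0 ?ltW//.
have -> : (eta1 - D) / 2 * ((eta1 + D) / 2) = (eta1 ^+ 2 - D ^+ 2) / 4 by field.
by rewrite D2 (_ : _ / 4 = 1) ?sqrtr1//; field.
Qed.

(** Since [beta1^2 + beta2^2 = 1], completing the square leaves [beta2^2]. The parameter [c] stands
    for both [beta1] and its opposite. *)
Lemma log_argument_gt0 (x c : R) : -2 < eta1 < 2 -> c ^+ 2 = beta1 eta1 ^+ 2 ->
  0 < x ^+ 2 + 2 * c * x + 1.
Proof.
move=> /beta12E[_ b20 b1E b2E] c2.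
rewrite (_ : _ + 1 = (x + c) ^+ 2 + beta2 eta1 ^+ 2); last by lra.
by rewrite ltr_wpDl ?sqr_ge0// exprn_gt0.
Qed.

(** Splits the logarithm and writes the shift as [+ - beta1], the shapes that the derivative lemmas
    for [ln] and [atan] expect. *)
Lemma V3_small : -2 < eta1 < 2 -> V3 eta1 = fun x =>
  1 / (4 * beta1 eta1) * (ln (x ^+ 2 - 2 * beta1 eta1 * x + 1) -
                          ln (x ^+ 2 + 2 * beta1 eta1 * x + 1)) +
  1 / (2 * beta2 eta1) * (atan ((x + - beta1 eta1) / beta2 eta1) +
                          atan ((x + beta1 eta1) / beta2 eta1)).
Proof.
move=> h; apply/funext => x; rewrite /V3.
have -> : `|eta1| < 2 by rewrite ltr_norml.
rewrite ln_div// posrE ?log_argument_gt0//.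
by have := log_argument_gt0 x h (sqrrN _); rewrite mulrN mulNr.
Qed.

(** In each regime the terms of [V3] differentiate to a partial fraction decomposition along the
    factorization of the denominator: two real quadratics with linear terms, two of the form
    [omega^2 + x^2], or one squared. *)
Lemma is_derive_V3 (x : R) : -2 < eta1 ->
  is_derive x (1 : R) (V3 eta1) (2 * x ^+ 2 / (1 + eta1 * x ^+ 2 + x ^+ 4)).
Proof.
move=> h; have D0 := fgc_denominator_gt0 x h.
have [eta1_lt2|eta1_gt2|eta1_eq2] := ltgtP eta1 2.
- have hh : -2 < eta1 < 2 by rewrite h.
  have [b10 b20 b1E b2E] := beta12E hh; rewrite V3_small//.
  set b1 := beta1 eta1 in b10 b1E *; set b2 := beta2 eta1 in b20 b2E *.
  have bb : b1 ^+ 2 + b2 ^+ 2 = 1 by rewrite b1E b2E; field.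
  have eta1E : eta1 = 2 - 4 * b1 ^+ 2 by rewrite b1E; field.
  have qp := log_argument_gt0 x hh erefl.
  have qm := log_argument_gt0 x hh (sqrrN _).
  have dp : is_derive x (1 : R) (fun x : R => x ^+ 2 + 2 * b1 * x + 1) (2 * x + 2 * b1).
    by apply: is_derive_eq; rewrite /GRing.scale/=; ring.
  have dm : is_derive x (1 : R) (fun x : R => x ^+ 2 - 2 * b1 * x + 1) (2 * x - 2 * b1).
    by apply: is_derive_eq; rewrite /GRing.scale/=; ring.
  have qm' : 0 < x ^+ 2 - 2 * b1 * x + 1 by move: qm; rewrite mulrN mulNr.
  have dlp := @is_derive_ln_comp _ (fun x => x ^+ 2 + 2 * b1 * x + 1) _ _ qp dp.
  have dlm := @is_derive_ln_comp _ (fun x => x ^+ 2 - 2 * b1 * x + 1) _ _ qm' dm.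
  have dap := is_derive_atan_scaled b1 x b20.
  have dam := is_derive_atan_scaled (- b1) x b20.
  apply: is_derive_eq; rewrite /GRing.scale/=.
  (* By [bb] the arctangents have the same denominators as the logarithms. *)
  have -> : b2 ^+ 2 + (x - b1) ^+ 2 = x ^+ 2 - 2 * b1 * x + 1 by lra.
  have -> : b2 ^+ 2 + (x + b1) ^+ 2 = x ^+ 2 + 2 * b1 * x + 1 by lra.
  have -> : 1 + eta1 * x ^+ 2 + x ^+ 4 =
    (x ^+ 2 - 2 * b1 * x + 1) * (x ^+ 2 + 2 * b1 * x + 1) by rewrite eta1E; ring.
  by field; rewrite !gt_eqF.
- have [w10 w20 D1 wB [wD wM]] := omega12E eta1_gt2.
  rewrite /V3 [`|eta1|]gtr0_norm; last lra.
  rewrite ltNge (ltW eta1_gt2)/= gt_eqF//.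
  set w1 := omega1 eta1 in w10 wB wD wM *; set w2 := omega2 eta1 in w20 wB wD wM *.
  have datan w : 0 < w ->
      is_derive x (1 : R) (fun x : R => atan (x / w)) (w / (w ^+ 2 + x ^+ 2)).
    by move=> /(is_derive_atan_scaled 0 x); under eq_fun do rewrite addr0; rewrite addr0.
  have dw1 := datan _ w10; have dw2 := datan _ w20.
  apply: is_derive_eq; rewrite /GRing.scale/=.
  have -> : 1 + eta1 * x ^+ 2 + x ^+ 4 = (w1 ^+ 2 + x ^+ 2) * (w2 ^+ 2 + x ^+ 2).
    have -> : 1 = (w1 * w2) ^+ 2 by rewrite wM expr1n.
    by rewrite -wD; ring.
  have q w : 0 < w -> w ^+ 2 + x ^+ 2 != 0.
    by move=> w0; rewrite gt_eqF// ltr_wpDr ?sqr_ge0// exprn_gt0.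
  by rewrite -wB; field; rewrite wB (gt_eqF D1) !q.
- rewrite /V3 eta1_eq2 ger0_norm// ltxx eqxx.
  have x1 : 0 < 1 + x ^+ 2 by rewrite ltr_wpDr// sqr_ge0.
  have dV : is_derive x (1 : R) (fun x : R => (1 + x ^+ 2)^-1)
      (- (1 + x ^+ 2) ^- 2 * (2 * x)).
    have x1' : 1 + x ^+ 2 != 0 by rewrite gt_eqF.
    by apply: is_derive_eq; rewrite /GRing.scale/=; field.
  apply: is_derive_eq; rewrite /GRing.scale/=.
  have -> : 1 + 2 * x ^+ 2 + x ^+ 4 = (1 + x ^+ 2) ^+ 2 by ring.
  by field; rewrite gt_eqF.
Qed.

End V3_derivative.

(** * Behaviour of [V3] at 0 and at infinity *)

Section V3_limits.
Variables (R : realType) (eta1 : R).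

Lemma V3_0 : -2 < eta1 -> V3 eta1 0 = 0.
Proof.
move=> h; rewrite /V3; case: ifPn => _; last case: ifPn => _.
- rewrite expr0n/= !mulr0 subr0 !add0r divr1 ln1 mulr0 add0r.
  by rewrite mulNr atanN addNr mulr0.
- by rewrite atan0 mul0r subr0.
- by rewrite !mul0r atan0 !mulr0 oppr0 addr0 mulr0.
Qed.

Lemma cvgy_shift_scale (a b : R) : 0 < b -> (x + a) / b @[x --> +oo] --> +oo.
Proof.
move=> b0; apply/cvgryPge => A; near=> x.
rewrite ler_pdivlMr// -lerBlDr; near: x; apply: nbhs_pinfty_ge; exact: num_real.
Unshelve. all: by end_near. Qed.

Lemma cvgy_atan_shift_scale (a b : R) : 0 < b ->
  atan ((x + a) / b) @[x --> +oo] --> pi / 2.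
Proof. by move=> b0; apply: cvg_comp (cvgy_shift_scale a b0) _; exact: cvgy_atan. Qed.

Lemma cvgy_inv : (x : R)^-1 @[x --> +oo] --> 0.
Proof. by apply/(gtr0_cvgV0 (f := id)); [exact: nbhs_pinfty_gt|exact: cvg_id]. Qed.

(** For [x > 0] the quotient lies between [1 - 4 b / x] and 1, so it tends to 1. *)
Lemma cvgy_log_quotient (b : R) : 0 <= b ->
  ln ((x ^+ 2 - 2 * b * x + 1) / (x ^+ 2 + 2 * b * x + 1)) @[x --> +oo] --> 0.
Proof.
move=> b0; rewrite -[X in _ --> X]ln1.
have qcvg : (x ^+ 2 - 2 * b * x + 1) / (x ^+ 2 + 2 * b * x + 1) @[x --> +oo] --> (1 : R);
  last exact: cvg_comp qcvg (continuous_ln ltr01).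
apply: (@squeeze_cvgr _ _ _ _ (fun x : R => 1 - 4 * b * x^-1) (fun=> 1)).
- near=> x; have x0 : 0 < x by near: x; exact: nbhs_pinfty_gt.
  have bx : 0 <= b * x by rewrite mulr_ge0// ltW.
  have q0 : 0 < x ^+ 2 + 2 * b * x + 1.
    by rewrite ltr_wpDl// addr_ge0 ?sqr_ge0// -mulrA mulr_ge0.
  rewrite ler_pdivrMr// ler_pdivlMr// mul1r; apply/andP; split; last lra.
  rewrite -subr_ge0 (_ : _ - _ = 4 * b * (2 * b + x^-1)).
    by rewrite mulr_ge0 ?addr_ge0 ?mulr_ge0 ?invr_ge0// ltW.
  by field; rewrite gt_eqF.
- rewrite -[X in _ --> X]subr0 -[in X in _ --> X](mulr0 (4 * b)).
  by apply: cvgB; [exact: cvg_cst|apply: cvgM; [exact: cvg_cst|exact: cvgy_inv]].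
- exact: cvg_cst.
Unshelve. all: by end_near. Qed.

(** What remains when every arctangent becomes [pi / 2]. The last branch is
    [pi (omega2 - omega1) / Delta], simplified by [Delta = omega2^2 - omega1^2]. *)
Definition V3_limit : R :=
  if `|eta1| < 2 then pi / (2 * beta2 eta1)
  else if eta1 == 2 then pi / 2
  else pi / (omega1 eta1 + omega2 eta1).

Lemma cvgy_V3 : -2 < eta1 -> V3 eta1 x @[x --> +oo] --> V3_limit.
Proof.
move=> h; rewrite /V3 /V3_limit.
have [eta1_lt2|eta1_gt2|eta1_eq2] := ltgtP eta1 2.
- have hh : -2 < eta1 < 2 by rewrite h.
  have [b10 b20 _ _] := beta12E hh; have -> : `|eta1| < 2 by rewrite ltr_norml.
  have -> : pi / (2 * beta2 eta1) =
      1 / (4 * beta1 eta1) * 0 + 1 / (2 * beta2 eta1) * (pi / 2 + pi / 2).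
    by field; rewrite !gt_eqF.
  apply: cvgD; apply: cvgM; [exact: cvg_cst| |exact: cvg_cst|].
    exact/cvgy_log_quotient/ltW.
  by apply: cvgD; exact: cvgy_atan_shift_scale.
- have [w10 w20 D0 wB [wD wM]] := omega12E eta1_gt2.
  rewrite gtr0_norm ?(lt_trans _ eta1_gt2)// (ltNge eta1) (ltW eta1_gt2)/=.
  have datan (w : R) : 0 < w -> atan (x / w) @[x --> +oo] --> pi / 2.
    by move=> w0; have := cvgy_atan_shift_scale 0 w0; under eq_fun do rewrite addr0.
  have -> : pi / (omega1 eta1 + omega2 eta1) = 2 / Delta eta1 *
      (- (omega1 eta1 * (pi / 2)) + omega2 eta1 * (pi / 2)).
    by rewrite -wB; field; rewrite wB !gt_eqF// addr_gt0.
  apply: cvgM; first exact: cvg_cst.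
  apply: cvgD; [apply: cvgN|]; apply: cvgM; try exact: cvg_cst; exact: datan.
- rewrite ger0_norm ?eta1_eq2// ltxx -[pi / 2]subr0.
  apply: cvgB; first exact: cvgy_atan.
  apply: (@squeeze_cvgr _ _ _ _ (fun=> 0) (fun x : R => x^-1)).
  + near=> x; have x0 : 0 < x by near: x; exact: nbhs_pinfty_gt.
    have x1 : 0 < 1 + x ^+ 2 by rewrite ltr_wpDr// sqr_ge0.
    rewrite divr_ge0 ?(ltW x0) ?(ltW x1)//= ler_pdivrMr// mulrDr mulr1 expr2 mulrA.
    by rewrite mulVf ?gt_eqF// mul1r lerDr invr_ge0 ltW.
  + exact: cvg_cst.
  + exact: cvgy_inv.
Unshelve. all: by end_near. Qed.

Lemma V3_limit_gt0 : -2 < eta1 -> 0 < V3_limit.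
Proof.
move=> h; have pi0 := pi_gt0 R; rewrite /V3_limit.
have [eta1_lt2|eta1_gt2|eta1_eq2] := ltgtP eta1 2.
- have hh : -2 < eta1 < 2 by rewrite h.
  have [_ b20 _ _] := beta12E hh; have -> : `|eta1| < 2 by rewrite ltr_norml.
  by rewrite divr_gt0// mulr_gt0.
- have [w10 w20 _ _ _] := omega12E eta1_gt2.
  rewrite gtr0_norm ?(lt_trans _ eta1_gt2)// (ltNge eta1) (ltW eta1_gt2)/=.
  by rewrite divr_gt0// addr_gt0.
- by rewrite ger0_norm ?eta1_eq2// ltxx divr_gt0.
Qed.

Lemma powR_cube_third (a b : R) : 0 <= a -> 0 <= b ->
  (a ^+ 3 * b) `^ (3^-1) = a * b `^ (3^-1).
Proof.
move=> a0 b0; rewrite powRM ?exprn_ge0// -powR_mulrn// -powRrM.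
by rewrite mulfV ?pnatr_eq0// powRr1.
Qed.

(** In every branch [4 pi^2 / V3_limit] is 8 times the quantity under the cube root in
    [limit_scale], and the 8 comes out as the factor 2. *)
Lemma limit_scaleE (xi : R) : -2 < eta1 ->
  limit_scale eta1 xi = xi * (4 * pi ^+ 2 / V3_limit) `^ (3^-1).
Proof.
move=> h; rewrite /limit_scale /V3_limit; move: (@pi R) (pi_gt0 R) => p p0.
have two t u : 0 <= t -> u = 2 ^+ 3 * t ->
    2 * xi * t `^ (3^-1) = xi * u `^ (3^-1).
  by move=> t0 ->; rewrite powR_cube_third// mulrCA mulrA.
have [eta1_lt2|eta1_gt2|eta1_eq2] := ltgtP eta1 2.
- have hh : -2 < eta1 < 2 by rewrite h.
  have [_ b20 _ _] := beta12E hh; have -> : `|eta1| < 2 by rewrite ltr_norml.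
  apply: two; first by rewrite mulr_ge0// ltW.
  by field; rewrite !gt_eqF.
- have [w10 w20 _ _ _] := omega12E eta1_gt2.
  rewrite gtr0_norm ?(lt_trans _ eta1_gt2)// (ltNge eta1) (ltW eta1_gt2)/=.
  apply: two; first by rewrite divr_ge0// mulr_ge0 ?addr_ge0 ?ltW.
  by field; rewrite !gt_eqF// addr_gt0.
- rewrite ger0_norm ?eta1_eq2// ltxx; apply: two; first exact: ltW.
  by field; rewrite gt_eqF.
Qed.

End V3_limits.

(** * The integral scale *)

(** The spectral density as a function of [|k|], without the cutoff: it has no jump at [kc], and the
    domain of integration supplies the truncation. *)
Definition radial_density (R : realType) (eta0 eta1 xi r : R) : R :=
  eta0 * xi ^+ 3 / (1 + eta1 * (r * xi) ^+ 2 + (r * xi) ^+ 4).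

Lemma fgc_denominator_lower_bound (R : realType) (eta1 : R) : -2 < eta1 ->
  exists2 m : R, 0 < m & forall u, m <= 1 + eta1 * u ^+ 2 + u ^+ 4.
Proof.
move=> h; have [e0|e0] := leP 0 eta1.
  exists 1 => // u; rewrite -addrA lerDl addr_ge0//; last by rewrite exprn_even_ge0.
  by rewrite mulr_ge0// sqr_ge0.
(* The minimum of [1 + eta1 t + t^2], reached at [t = - eta1 / 2], where [t] stands for [u^2]. *)
exists (1 - eta1 ^+ 2 / 4) => [|u].
  have -> : 1 - eta1 ^+ 2 / 4 = (2 - eta1) * (2 + eta1) / 4 by field.
  by rewrite divr_gt0// mulr_gt0//; lra.
by have := sqr_ge0 (u ^+ 2 + eta1 / 2); lra.
Qed.

Lemma radial_density_lipschitz (R : realType) (eta0 eta1 xi c : R) :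
  0 < eta0 -> 0 < xi -> -2 < eta1 -> 0 <= c ->
  exists2 L : R, 0 <= L & forall x y, 0 <= x -> x <= y -> y <= c ->
    `|radial_density eta0 eta1 xi y - radial_density eta0 eta1 xi x| <= L * (y - x).
Proof.
move=> eta00 xi0 h c0; have [m m0 mD] := fgc_denominator_lower_bound h.
(* A Lipschitz constant of the denominator on [[0, c]]: factor [y - x] out of the differences of
   squares and of fourth powers, then use [x + y <= 2 c] and [x^2 + y^2 <= 2 c^2]. *)
pose M := `|eta1| * xi ^+ 2 * (2 * c) + xi ^+ 4 * (4 * c ^+ 3).
have M0 : 0 <= M.
  by rewrite /M addr_ge0// ?mulr_ge0 ?exprn_ge0// ltW.
pose A := eta0 * xi ^+ 3; have A0 : 0 <= A by rewrite mulr_ge0 ?exprn_ge0// ltW.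
exists (A * M / m ^+ 2) => [|x y x0 xy yc].
  by rewrite divr_ge0 ?sqr_ge0// mulr_ge0.
rewrite /radial_density -/A.
set Dx := 1 + eta1 * (x * xi) ^+ 2 + _; set Dy := 1 + eta1 * (y * xi) ^+ 2 + _.
have Dx0 : 0 < Dx := lt_le_trans m0 (mD _).
have Dy0 : 0 < Dy := lt_le_trans m0 (mD _).
have -> : A / Dy - A / Dx = A * (Dx - Dy) / (Dx * Dy) by field; rewrite !gt_eqF.
rewrite normrM normfV (gtr0_norm (mulr_gt0 Dx0 Dy0)) normrM (ger0_norm A0).
have xc := le_trans xy yc; have y0 := le_trans x0 xy.
have yx : 0 <= y - x by rewrite subr_ge0.
have DM : `|Dx - Dy| <= M * (y - x).
  have -> : Dx - Dy = - (eta1 * xi ^+ 2 * ((x + y) * (y - x)) +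
      xi ^+ 4 * ((x ^+ 2 + y ^+ 2) * (x + y) * (y - x))) by rewrite /Dx /Dy; ring.
  rewrite normrN; apply: le_trans (ler_normD _ _) _; rewrite /M [leRHS]mulrDl.
  have xy2 : x + y <= 2 * c by lra.
  have sq (t : R) : 0 <= t -> t <= c -> t ^+ 2 <= c ^+ 2.
    by move=> t0 tc; rewrite lerXn2r ?nnegrE.
  have xi2 : 0 <= xi ^+ 2 := sqr_ge0 _.
  have xi4 : 0 <= xi ^+ 4 by rewrite exprn_even_ge0.
  have s0 : 0 <= x + y by rewrite addr_ge0.
  have q0 : 0 <= x ^+ 2 + y ^+ 2 by rewrite addr_ge0 ?sqr_ge0.
  apply: lerD.
    rewrite -[X in `|X|]mulrA normrM (ger0_norm (mulr_ge0 xi2 (mulr_ge0 s0 yx))).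
    have -> : `|eta1| * xi ^+ 2 * (2 * c) * (y - x) =
      `|eta1| * (xi ^+ 2 * (2 * c * (y - x))) by ring.
    by apply: ler_wpM2l => //; apply: ler_wpM2l => //; exact: ler_wpM2r.
  rewrite (ger0_norm (mulr_ge0 xi4 (mulr_ge0 (mulr_ge0 q0 s0) yx))) -[leRHS]mulrA.
  rewrite ler_wpM2l// ler_wpM2r//.
  have -> : 4 * c ^+ 3 = (2 * c ^+ 2) * (2 * c) by ring.
  by apply: ler_pM => //; have := sq _ x0 xc; have := sq _ y0 yc; lra.
have -> : A * M / m ^+ 2 * (y - x) = A * (M * (y - x)) / (m * m).
  by field; rewrite gt_eqF.
apply: ler_pM.
- by rewrite mulr_ge0.
- by rewrite invr_ge0 mulr_ge0// ltW.
- by rewrite ler_wpM2l.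
- by rewrite lef_pV2 ?posrE ?mulr_gt0// ler_pM ?mD// ltW.
Qed.

Lemma measurable_radial_density (R : realType) (eta0 eta1 xi : R) : -2 < eta1 ->
  measurable_fun setT (radial_density eta0 eta1 xi).
Proof.
move=> h; apply: continuous_measurable_fun => x.
apply: cvgM; first exact: cvg_cst.
apply: cvgV; first by rewrite gt_eqF// fgc_denominator_gt0.
pose D (x : R) := 1 + eta1 * (x * xi) ^+ 2 + (x * xi) ^+ 4.
suff : derivable D x 1 by move/derivable1_diffP/differentiable_continuous.
exact: ex_derive.
Qed.

Lemma integral_ball3_fgc_density (R : realType) (eta0 eta1 xi kc : R) :
  0 < eta0 -> 0 < xi -> -2 < eta1 -> 0 <= kc ->
  \int[lebesgue3]_(k in ball3 kc) fgc_density eta0 eta1 xi kc k =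
  2 * pi * eta0 * V3 eta1 (kc * xi).
Proof.
move=> eta00 xi0 h kc0.
(* By the chain rule the derivative is [2 pi eta0 xi] times [2 (r xi)^2] over the denominator, that
   is [4 pi r^2] times the radial density. *)
pose G (r : R) := 2 * pi * eta0 * V3 eta1 (r * xi).
have dG (r : R) : is_derive r (1 : R) G
    (4 * pi * r ^+ 2 * radial_density eta0 eta1 xi r).
  have dr : is_derive r (1 : R) (fun r : R => r * xi) xi.
    by apply: is_derive_eq; rewrite /GRing.scale/=; ring.
  have dV := @is_derive1_comp _ (V3 eta1) (fun r => r * xi) r _ _
    (is_derive_V3 (r * xi) h) dr.
  have := @is_deriveZ _ _ _ (V3 eta1 \o (fun r : R => r * xi)) (2 * pi * eta0) _ _ _ dV.
  move=> dZ; apply: (is_derive_eq dZ); rewrite /GRing.scale/= /radial_density.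
  move: (@pi R) => p; field.
  by rewrite gt_eqF// fgc_denominator_gt0.
have [L L0 Lf] := radial_density_lipschitz eta00 xi0 h kc0.
transitivity (\int[lebesgue3]_(k in ball3 kc) radial_density eta0 eta1 xi (norm3 k)).
  by apply: eq_Rintegral => k; rewrite inE => kb; rewrite /fgc_density ifT.
rewrite (Rintegral_ball3_radial kc0 L0 (measurable_radial_density _ _ h) Lf dG).
by rewrite /G mul0r V3_0// mulr0 subr0.
Qed.

Lemma fgc_density_ge0 (R : realType) (eta0 eta1 xi kc : R) k :
  0 < eta0 -> 0 < xi -> -2 < eta1 -> 0 <= fgc_density eta0 eta1 xi kc k.
Proof.
move=> eta00 xi0 h; rewrite /fgc_density; case: ifPn => // _.
by rewrite divr_ge0 ?mulr_ge0 ?exprn_ge0 ?ltW// fgc_denominator_gt0.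
Qed.

(** With [eta0 = xi = 1], [V3] is up to the factor [2 pi] the integral of a nonnegative density,
    which avoids a study of the three formulas. *)
Lemma V3_ge0 (R : realType) (eta1 x : R) : -2 < eta1 -> 0 <= x -> 0 <= V3 eta1 x.
Proof.
move=> h x0; have := integral_ball3_fgc_density ltr01 ltr01 h x0.
rewrite !mulr1 => e; rewrite -(pmulr_rge0 _ (_ : 0 < 2 * pi)); last first.
  by rewrite mulr_gt0// pi_gt0.
by rewrite -e; apply: Rintegral_ge0 => k _; exact: fgc_density_ge0.
Qed.

(** At [r = 0] the exponential is 1, and dividing [2 pi eta0 V3] by [(2 pi)^3] leaves [4 pi^2]
    below. *)
Lemma fgc_covariance0 (R : realType) (eta0 eta1 xi kc : R) :
  0 < eta0 -> 0 < xi -> -2 < eta1 -> 0 <= kc ->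
  complex.Re (fgc_covariance eta0 eta1 xi kc 0) =
  eta0 * V3 eta1 (kc * xi) / (4 * pi ^+ 2).
Proof.
move=> eta00 xi0 h kc0; rewrite /fgc_covariance /Cintegral3/= mul0r subr0.
transitivity (((2 * pi) ^+ 3)^-1 *
    \int[lebesgue3]_(k in ball3 kc) fgc_density eta0 eta1 xi kc k).
  congr (_ * _); apply: eq_Rintegral => k _.
  by rewrite /dot3/= !mulr0 !addr0 cos0 mul1r subr0.
rewrite integral_ball3_fgc_density//; move: (@pi R) (pi_gt0 R) => p p0.
by field; rewrite (gt_eqF p0).
Qed.

Lemma integral_scale_fgc (R : realType) (eta0 eta1 xi kc : R)
    (d : measure_display) (T : measurableType d) (P : probability T R)
    (X : R * R * R -> {RV P >-> R}) :
  0 < eta0 -> 0 < xi -> -2 < eta1 -> 0 < kc -> is_FGC_SSRF eta0 eta1 xi kc X ->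
  integral_scale X (fgc_density eta0 eta1 xi kc) =
  xi * (4 * pi ^+ 2 / V3 eta1 (kc * xi)) `^ (3^-1).
Proof.
move=> eta00 xi0 h kc0 XF; rewrite /integral_scale.
have -> : covfun X 0 = eta0 * V3 eta1 (kc * xi) / (4 * pi ^+ 2).
  by rewrite -fgc_covariance0 ?(ltW kc0)// -(fgc_covfun XF).
have -> : fgc_density eta0 eta1 xi kc 0 = eta0 * xi ^+ 3.
  have n0 : norm3 (0 : R * R * R) = 0 by rewrite /norm3 /dot3/= !mulr0 !addr0 sqrtr0.
  by rewrite /fgc_density n0 (ltW kc0) mul0r !expr0n/= mulr0 !addr0 divr1.
have V0 : 0 <= V3 eta1 (kc * xi) by rewrite V3_ge0// mulr_ge0// ltW.
rewrite -powR_cube_third ?(ltW xi0)//; last by rewrite divr_ge0// mulr_ge0// sqr_ge0.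
(* If [V3] vanishes, both sides are 0 because the inverse of 0 is 0; otherwise [eta0] cancels. *)
congr (_ `^ _); have [->|Vn0] := eqVneq (V3 eta1 (kc * xi)) 0.
  by rewrite mulr0 mul0r invr0 !mulr0.
by move: (@pi R) (pi_gt0 R) => p p0; field; rewrite Vn0 !gt_eqF.
Qed.

Theorem mainTheorem12 (R : realType) (eta0 eta1 xi : R)
    (heta0 : 0 < eta0) (hxi : 0 < xi) (heta1 : -2 < eta1) :
  (forall kc : R, 0 < kc ->
     forall (d : measure_display) (T : measurableType d)
       (P : probability T R) (X : R * R * R -> {RV P >-> R}),
     is_FGC_SSRF eta0 eta1 xi kc X ->
     integral_scale X (fgc_density eta0 eta1 xi kc) =
     xi * (4 * pi ^+ 2 / V3 eta1 (kc * xi)) `^ (3^-1))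
  /\
  (forall (d : R -> measure_display) (T : forall kc : R, measurableType (d kc))
     (P : forall kc : R, probability (T kc) R)
     (X : forall kc : R, R * R * R -> {RV (P kc) >-> R}),
   (forall kc : R, 0 < kc -> is_FGC_SSRF eta0 eta1 xi kc (X kc)) ->
   integral_scale (X kc) (fgc_density eta0 eta1 xi kc) @[kc --> +oo]
     --> limit_scale eta1 xi).
Proof.
split=> [kc kc0 d T P X|d T P X XF]; first exact: integral_scale_fgc.
rewrite limit_scaleE//.
have Vxi : V3 eta1 (kc * xi) @[kc --> +oo] --> V3_limit eta1.
  apply: cvg_comp (cvgy_V3 heta1).
  by apply: gt0_cvgMly => //; exact: cvg_id.
have l0 := V3_limit_gt0 heta1.
(* The closed form holds for [kc > 0], hence eventually, so its limit is the one to compute. *)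
suff : xi * (4 * pi ^+ 2 / V3 eta1 (kc * xi)) `^ (3^-1) @[kc --> +oo] -->
    xi * (4 * pi ^+ 2 / V3_limit eta1) `^ (3^-1).
  apply: cvg_trans; apply: near_eq_cvg; near=> kc; apply/esym.
  have kc0 : 0 < kc by near: kc; exact: nbhs_pinfty_gt.
  exact: integral_scale_fgc (XF kc kc0).
apply: cvgM; first exact: cvg_cst.
have c0 : 0 < 4 * pi ^+ 2 / V3_limit eta1.
  by rewrite divr_gt0// mulr_gt0// exprn_gt0// pi_gt0.
(* The cube root is derivable, hence continuous, at this positive value. *)
have powR_cont : {for 4 * pi ^+ 2 / V3_limit eta1,
    continuous (fun a : R => a `^ (3^-1))}.
  apply/differentiable_continuous/derivable1_diffP/derivable_powR.
  by rewrite in_itv/= c0.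
have ratio : 4 * pi ^+ 2 / V3 eta1 (kc * xi) @[kc --> +oo] -->
    4 * pi ^+ 2 / V3_limit eta1; last exact: cvg_comp ratio powR_cont.
apply: cvgM; first exact: cvg_cst.
by apply: cvgV => //; rewrite gt_eqF.
Unshelve. all: by end_near. Qed.
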